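(* For every finite digraph $G$, $\mathsf{cr}(G)=\mathrm{wcol}^{\rightarrow}_{\infty}(G)-1$.
   Context: Cycle rank $\mathsf{cr}(G)$: $0$ if $G$ is acyclic; $1+\min_{v\in V(G)}\mathsf{cr}(G-v)$ if $G$ is strongly connected with at least one edge; otherwise the maximum cycle rank over the strongly connected components of $G$. Weak $(\infty,\rightarrow)$-coloring number: for a linear ordering $L$ of $V(G)$ with induced order $\le_L$, and a vertex $v$, let $\mathrm{WReach}^{\rightarrow}_{\infty}[G,L,v]$ be the set of vertices $w$ with $w\le_L v$ such that there is a directed path $P$ from $v$ to $w$ in $G$ (of any length, including length $0$) with $w\le_L u$ for every vertex $u$ of $P$. Then $\mathrm{wcol}^{\rightarrow}_{\infty}(G)=\min_L\max_{v\in V(G)}|\mathrm{WReach}^{\rightarrow}_{\infty}[G,L,v]|$, the minimum over all linear orderings $L$ of $V(G)$.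
   Formalization: Digraphs are taken to be without loops, since a single vertex with a loop has cycle rank 1 but weak coloring number 1; for the empty digraph the subtraction is truncated at 0. *)

(* Defs.v *)
(* A finite digraph is a finite vertex type T with an arc
   relation e : rel T; antiparallel arcs are allowed. *)
From mathcomp Require Import all_boot.

Set Implicit Arguments.
Unset Strict Implicit.
Unset Printing Implicit Defensive.

(* The value 0 on the empty set is a dummy. *)
Definition min_over (I : finType) (A : {set I}) (F : I -> nat) : nat :=
  if [pick x in A] is Some x0 then F [arg min_(x < x0 in A) F x] else 0.

Lemma min_overP (I : finType) (A : {set I}) (F : I -> nat) :
  A != set0 ->
  (exists2 x, x \in A & min_over A F = F x) /\
  (forall y, y \in A -> min_over A F <= F y).
Proof.
case/set0Pn=> z zA; rewrite /min_over; case: pickP => [x0 x0A|]; last first.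
  by move/(_ z); rewrite zA.
by case: arg_minnP => // x xA xmin; split=> //; exists x.
Qed.

Lemma eq_min_over (I : finType) (A : {set I}) (F1 F2 : I -> nat) :
  {in A, F1 =1 F2} -> min_over A F1 = min_over A F2.
Proof.
move=> eqF; have [->|A0] := eqVneq A set0.
  by rewrite /min_over; case: pickP => // x; rewrite inE.
have [[x xA Ex] min1] := min_overP F1 A0.
have [[y yA Ey] min2] := min_overP F2 A0.
apply/eqP; rewrite eqn_leq {1}Ey -(eqF y yA) min1 //=.
by rewrite Ex (eqF x xA) min2.
Qed.

(* The subgraph induced on A. All the notions below concern this subgraph, so
   that G - v and the strong components of G are again given by vertex sets. *)
Definition induced (T : finType) (e : rel T) (A : {set T}) : rel T :=
  [rel x y | [&& x \in A, y \in A & e x y]].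

Definition has_arc (T : finType) (e : rel T) (A : {set T}) : bool :=
  [exists x, exists y, induced e A x y].

(* A loop counts as a cycle; see acyclicP. *)
Definition acyclic (T : finType) (e : rel T) (A : {set T}) : bool :=
  ~~ [exists x, exists y, induced e A x y && connect (induced e A) y x].

Definition strongly_connected (T : finType) (e : rel T) (A : {set T}) : bool :=
  [forall x in A, forall y in A, connect (induced e A) x y].

Definition mutually_reachable (T : finType) (e : rel T) (A : {set T}) : rel T :=
  [rel x y | connect (induced e A) x y && connect (induced e A) y x].

Definition strong_components (T : finType) (e : rel T) (A : {set T}) :
    {set {set T}} :=
  equivalence_partition (mutually_reachable e A) A.

(* n bounds the recursion depth; n = #|A| is enough, as cycle_rank_onE shows. *)
Fixpoint cycle_rank_rec (T : finType) (e : rel T) (n : nat) (A : {set T}) :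
    nat :=
  if n is m.+1 then
    if acyclic e A then 0
    else if strongly_connected e A && has_arc e A then
      1 + min_over A (fun v => cycle_rank_rec e m (A :\ v))
    else \max_(C in strong_components e A) cycle_rank_rec e m C
  else 0.

Definition cycle_rank_on (T : finType) (e : rel T) (A : {set T}) : nat :=
  cycle_rank_rec e #|A| A.

Definition cycle_rank (T : finType) (e : rel T) : nat :=
  cycle_rank_on e [set: T].

Lemma acyclicP (T : finType) (e : rel T) (A : {set T}) :
  reflect (forall c : seq T, ucycle (induced e A) c -> c = [::])
          (acyclic e A).
Proof.
apply: (iffP idP) => [/existsPn acyc|acyc].
  case=> // x p /andP[/= cyc _]; exfalso; have /existsPn := acyc x.
  case: p cyc => [|y p] /= /andP[exy pth].
    by move/(_ x); rewrite exy connect0.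
  move/(_ y); rewrite exy /=; case/negP.
  by apply/connectP; exists (rcons p x) => //; rewrite last_rcons.
apply/existsPn=> x; apply/existsPn=> y; apply/negP=> /andP[exy].
case/connectP=> p /shortenP[q pq uq _] xE.
have // : y :: q = [::]; apply: acyc; rewrite /ucycle uq andbT /=.
by rewrite rcons_path pq -xE.
Qed.

Lemma mutually_reachable_equiv (T : finType) (e : rel T) (A : {set T}) :
  {in A & &, equivalence_rel (mutually_reachable e A)}.
Proof.
move=> x y z _ _ _; rewrite /mutually_reachable /= connect0; split=> //.
case/andP=> xy yx; congr (_ && _); apply/idP/idP => h.
- exact: connect_trans yx h.
- exact: connect_trans xy h.
- exact: connect_trans h xy.
- exact: connect_trans h yx.
Qed.

Lemma strong_components_partition (T : finType) (e : rel T) (A : {set T}) :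
  partition (strong_components e A) A.
Proof. exact/equivalence_partitionP/mutually_reachable_equiv. Qed.

Lemma strong_component_proper (T : finType) (e : rel T) (A C : {set T}) :
  ~~ strongly_connected e A -> C \in strong_components e A -> C \proper A.
Proof.
move=> nsc CA; have /and3P[/eqP covA _ _] := strong_components_partition e A.
have CsubA : C \subset A by rewrite -covA; apply: bigcup_sup CA.
rewrite properEneq CsubA andbT; apply: contra nsc => /eqP eqCA.
case/imsetP: CA => z zA; rewrite eqCA => defA.
apply/forall_inP=> x; rewrite {1}defA inE => /and3P[_ _ xz].
apply/forall_inP=> y; rewrite {1}defA inE => /and3P[_ zy _].
exact: connect_trans xz zy.
Qed.

Lemma cycle_rank_rec_stable (T : finType) (e : rel T) (m n : nat)
    (A : {set T}) :
  #|A| <= m -> #|A| <= n -> cycle_rank_rec e m A = cycle_rank_rec e n A.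
Proof.
have acyc0 (B : {set T}) : #|B| <= 0 -> acyclic e B.
  rewrite leqn0 cards_eq0 => /eqP->.
  by apply/existsPn=> x; apply/existsPn=> y; rewrite /induced /= in_set0.
elim: m n A => [|m IHm] [|n] A //= leAm leAn; try by rewrite acyc0.
case: ifP => // nacyc; case: ifP => [_|nsc].
  congr (_ + _); apply: eq_min_over => v vA.
  by rewrite (cardsD1 v A) vA in leAm leAn; apply: IHm.
have arcA : has_arc e A.
  move/negbFE/existsP: nacyc => [x /existsP[y /andP[exy _]]].
  by apply/existsP; exists x; apply/existsP; exists y.
apply: eq_bigr => C CA.
have /proper_card ltCA : C \proper A.
  by apply: strong_component_proper CA; rewrite arcA andbT in nsc; rewrite nsc.
by apply: IHm; rewrite -ltnS (leq_trans ltCA).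
Qed.

(* The defining recursion of cycle rank. *)
Lemma cycle_rank_onE (T : finType) (e : rel T) (A : {set T}) :
  cycle_rank_on e A =
    if acyclic e A then 0
    else if strongly_connected e A && has_arc e A then
      1 + min_over A (fun v => cycle_rank_on e (A :\ v))
    else \max_(C in strong_components e A) cycle_rank_on e C.
Proof.
rewrite {1}/cycle_rank_on.
rewrite (@cycle_rank_rec_stable _ _ _ #|A|.+1) //=.
case: ifP => // nacyc; case: ifP => _.
  congr (_ + _); apply: eq_min_over => v vA.
  by apply: cycle_rank_rec_stable; rewrite // subset_leq_card // subD1set.
apply: eq_bigr => C CA; apply: cycle_rank_rec_stable => //.
apply: subset_leq_card.
have /and3P[/eqP <- _ _] := strong_components_partition e A.
exact: bigcup_sup CA.
Qed.

(* A binary relation L on T is a set of pairs; (x, y) \in L means x <=_L y. *)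
Definition linear_order (T : finType) (L : {set T * T}) : bool :=
  [&& [forall x, (x, x) \in L],
      [forall x, forall y, ((x, y) \in L) && ((y, x) \in L) ==> (x == y)],
      [forall x, forall y, forall z,
         ((x, y) \in L) && ((y, z) \in L) ==> ((x, z) \in L)]
    & [forall x, forall y, ((x, y) \in L) || ((y, x) \in L)]].

Definition linear_orders (T : finType) : {set {set T * T}} :=
  [set L | linear_order L].

(* A path from v to w in the subgraph induced on the u with w <=_L u; see
   wreachP. *)
Definition wreach (T : finType) (e : rel T) (L : {set T * T}) (v : T) :
    {set T} :=
  [set w | ((w, v) \in L) &&
           connect (induced e [set u | (w, u) \in L]) v w].

Definition wcol (T : finType) (e : rel T) : nat :=
  min_over (linear_orders T) (fun L => \max_(v : T) #|wreach e L v|).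

Lemma wreachP (T : finType) (e : rel T) (L : {set T * T}) (v w : T) :
  reflect ((w, v) \in L /\
           exists p : seq T, [/\ path e v p, uniq (v :: p), last v p = w
             & forall u, u \in v :: p -> (w, u) \in L])
          (w \in wreach e L v).
Proof.
rewrite inE; apply: (iffP andP) => -[wv].
  case/connectP=> p /shortenP[q pq uq _] lq; split=> //; exists q; split=> //.
    by apply: sub_path pq => x y /and3P[].
  move=> u; rewrite inE => /predU1P[->//|].
  elim: q v {uq wv lq} pq => //= y q IH v /andP[/and3P[_ yw _] pq].
  by rewrite inE => /predU1P[->|/(IH _ pq)//]; rewrite inE in yw.
case=> p [pp _ lp all_p]; split=> //; apply/connectP; exists p => //.
elim: p v {wv lp} pp all_p => //= y p IH v /andP[vy pp] all_p.
have vyS : induced e [set u | (w, u) \in L] v y.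
  by apply/and3P; split=> //; rewrite inE; apply: all_p; rewrite !inE eqxx ?orbT.
by rewrite vyS; apply: IH => // u up; apply: all_p; rewrite inE up orbT.
Qed.

Lemma linear_orders_neq0 (T : finType) : linear_orders T != set0.
Proof.
apply/set0Pn; exists [set xy | enum_rank xy.1 <= enum_rank xy.2].
rewrite inE; apply/and4P; split; apply/forallP=> x; rewrite ?inE //=.
- apply/forallP=> y; rewrite !inE /= -eqn_leq; apply/implyP=> /eqP eqxy.
  by apply/eqP/enum_rank_inj/val_inj.
- apply/forallP=> y; apply/forallP=> z; rewrite !inE /=.
  by apply/implyP=> /andP[]; apply: leq_trans.
- by apply/forallP=> y; rewrite !inE leq_total.
Qed.

(* Truncated subtraction in wcol e - 1 is harmless as soon as T is inhabited;
   on the empty digraph cycle rank and wcol are both 0. *)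
Lemma wcol_gt0 (T : finType) (e : rel T) : 0 < #|T| -> 0 < wcol e.
Proof.
case/card_gt0P=> v _; rewrite /wcol.
have [[L]] := min_overP (fun L => \max_(v : T) #|wreach e L v|)
                (linear_orders_neq0 T).
rewrite inE => /and4P[/forallP Lxx _ _ _] -> _.
apply: leq_trans (leq_bigmax v); apply/card_gt0P; exists v.
by rewrite inE Lxx connect0.
Qed.

(* Main.v *)
(* Both inequalities are proved for all vertex sets A along the recursion of
   cycle rank. If the subgraph on A is strongly connected, its least vertex is
   weakly reachable from everywhere, so deleting it removes one vertex from
   every other weak reach; conversely, a vertex whose deletion minimizes the
   cycle rank is put first. Otherwise, the strong components are ordered
   topologically, sources first, so that nothing outside its own component is
   weakly reachable from a vertex. *)
Require Import Defs.
From mathcomp Require Import all_boot.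

Set Implicit Arguments.
Unset Strict Implicit.
Unset Printing Implicit Defensive.

Section WeakReach.

Variables (T : finType) (e : rel T).
Implicit Types (A B C S : {set T}) (f g : T -> nat) (v w x y : T).

(** * Paths in induced subgraphs and weak reach *)

Lemma connect_induced_mem S x y :
  connect (induced e S) x y -> (x == y) || (x \in S) && (y \in S).
Proof.
case/connectP=> p; elim: p x => [|z p IHp] x /= => [_ ->|].
  by rewrite eqxx.
case/andP=> /and3P[xS zS _] pp def_y; apply/orP; right; rewrite xS /=.
by case/predU1P: (IHp z pp def_y) => [<-|/andP[]].
Qed.

(** Every vertex of a path from [x] to [y] is reached from [x] and reaches [y]. This is what later
    confines a path between mutually reachable vertices to their strong component. *)
Lemma connect_induced_sub S S' x y :
    (forall z, connect (induced e S) x z -> connect (induced e S) z y ->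
      z \in S') ->
  connect (induced e S) x y -> connect (induced e S') x y.
Proof.
move=> subS; case/connectP=> p; elim: p x subS => [|z p IHp] x subS /=.
  by move=> _ ->.
case/andP=> exz pp def_y.
have zy : connect (induced e S) z y by apply/connectP; exists p.
have xz := connect1 exz.
apply: (@connect_trans _ _ z).
  apply: connect1; case/and3P: exz => _ _ exz; rewrite /induced /= exz.
  by rewrite (subS z) // (subS x) //; apply: connect_trans zy.
by apply: IHp => // t zt ty; apply: subS => //; apply: connect_trans zt.
Qed.

Lemma connect_induced_mono S S' x y :
  S \subset S' -> connect (induced e S) x y -> connect (induced e S') x y.
Proof.
move=> /subsetP subS; apply: connect_sub => a b /and3P[aS bS eab].
by apply: connect1; rewrite /induced /= !subS.
Qed.

(* The vertices are ordered by a rank function f, possibly with ties: breaking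
   the ties can only shrink the weak reach. *)
Definition wreach_on f A v : {set T} :=
  [set w in A | connect (induced e [set u in A | f w <= f u]) v w].

Lemma wreach_on_le f A v w : w \in wreach_on f A v -> f w <= f v.
Proof.
rewrite inE => /andP[_ /connect_induced_mem/predU1P[->//|]].
by rewrite inE => /andP[/andP[]].
Qed.

Lemma wreach_on_refl f A v : v \in A -> v \in wreach_on f A v.
Proof. by move=> vA; rewrite inE vA connect0. Qed.

Lemma wreach_onS f A B v :
  B \subset A -> wreach_on f B v \subset wreach_on f A v.
Proof.
move=> BA; apply/subsetP=> w; rewrite !inE => /andP[wB vw].
rewrite (subsetP BA) //=; apply: connect_induced_mono vw.
by apply/subsetP=> u; rewrite !inE => /andP[/(subsetP BA)-> ->].
Qed.

Lemma wreach_on_mono f g A v :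
    (forall x y, g x <= g y -> f x <= f y) ->
  wreach_on g A v \subset wreach_on f A v.
Proof.
move=> fg; apply/subsetP=> w; rewrite !inE => /andP[-> /=].
apply: connect_induced_mono; apply/subsetP=> u; rewrite !inE => /andP[-> /=].
exact: fg.
Qed.

(** * Strong components, and cycle rank bounded by weak reach *)

Lemma strong_component_sub A C : C \in strong_components e A -> C \subset A.
Proof.
have /and3P[/eqP covA _ _] := strong_components_partition e A.
by move=> CA; rewrite -covA; apply: bigcup_sup CA.
Qed.

Lemma nacyclic_has_arc A : ~~ acyclic e A -> has_arc e A.
Proof.
case/negPn/existsP=> x /existsP[y /andP[exy _]].
by apply/existsP; exists x; apply/existsP; exists y.
Qed.

Lemma cycle_rank_on_component A C :
    ~~ acyclic e A -> ~~ strongly_connected e A ->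
  C \in strong_components e A -> cycle_rank_on e C <= cycle_rank_on e A.
Proof.
move=> nac nsc CA; rewrite (cycle_rank_onE e A) (negPf nac) (negPf nsc) /=.
exact: (leq_bigmax_cond (F := cycle_rank_on e)).
Qed.

(** Induction on the size of [A]. Ties in [f] are harmless: any vertex minimizing [f] can be the
    deleted one, as all of [A] lies weakly above it. *)
Lemma cycle_rank_lt_wreach_on f A :
    irreflexive e -> A != set0 ->
  exists2 v, v \in A & cycle_rank_on e A < #|wreach_on f A v|.
Proof.
move=> loopless; have [n] := ubnP #|A|; elim: n A => // n IHn A leAn A0.
have [ac|nac] := boolP (acyclic e A).
  have /set0Pn[v vA] := A0; exists v => //.
  rewrite cycle_rank_onE ac; apply/card_gt0P.
  by exists v; apply: wreach_on_refl.
have arcA := nacyclic_has_arc nac.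
have [sc|nsc] := boolP (strongly_connected e A).
  have /set0Pn[z zA] := A0.
  have [w Aw w_min] := arg_minnP f zA.
  have wA : w \in A by [].
  (* Without loops, an arc has two distinct ends, so a vertex remains for the induction
     hypothesis. *)
  have Aw0 : A :\ w != set0.
    apply: contraTneq arcA => /eqP; rewrite setD_eq0 => /subsetP sub1.
    apply/existsPn=> x; apply/existsPn=> y; apply/negP=> /and3P[].
    by move=> /sub1/set1P-> /sub1/set1P->; rewrite loopless.
  have [|v vA' ltv] := IHn (A :\ w) _ Aw0.
    by move: leAn; rewrite (cardsD1 w A) wA.
  have /setD1P[_ vA] := vA'; exists v => //.
  rewrite cycle_rank_onE (negPf nac) sc arcA /=.
  have [_ /(_ w wA) le_min] :=
    min_overP (fun u => cycle_rank_on e (A :\ u)) A0.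
  (* The extra element is [w]: it is absent from [A :\ w], yet reached from [v], because the
     threshold set of [w] is the whole strongly connected set [A]. *)
  apply: (@leq_trans #|w |: wreach_on f (A :\ w) v|).
    by rewrite cardsU1 !inE eqxx /= !add1n ltnS (leq_ltn_trans le_min).
  apply/subset_leq_card; rewrite subUset wreach_onS ?subD1set // andbT sub1set.
  rewrite inE wA /=.
  have -> : [set u in A | f w <= f u] = A.
    by apply/setP=> u; rewrite inE; case uA: (u \in A) => //=; apply: w_min.
  by have /forall_inP/(_ v vA)/forall_inP := sc; apply.
have /set0Pn[z zA] := A0.
have /and3P[/eqP covA _ no0] := strong_components_partition e A.
have : 0 < #|strong_components e A|.
  apply/card_gt0P; exists (pblock (strong_components e A) z).
  by rewrite pblock_mem ?covA.
case/(eq_bigmax_cond (cycle_rank_on e)) => C CA maxC.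
have [||v vC ltv] := IHn C.
- rewrite -ltnS (leq_trans _ leAn) // ltnS.
  exact/proper_card/(strong_component_proper nsc).
- by apply: contraNneq no0 => <-.
exists v; first exact: subsetP (strong_component_sub CA) _ vC.
rewrite cycle_rank_onE (negPf nac) (negPf nsc) /= maxC (leq_trans ltv) //.
by rewrite subset_leq_card // wreach_onS // strong_component_sub.
Qed.

(** * Topological ranking of strong components *)

Definition ancestors A x : {set T} := [set y | connect (induced e A) y x].

(** The vertex [w] is its own ancestor but not one of [v]. So the number of ancestors is a
    topological rank: constant on strong components, strictly growing along any path that leaves
    one. *)
Lemma ancestors_card_lt A v w :
  connect (induced e A) v w -> ~~ connect (induced e A) w v ->
  #|ancestors A v| < #|ancestors A w|.
Proof.
move=> vw nwv; apply/proper_card/properP; split.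
  by apply/subsetP=> y; rewrite !inE => /connect_trans; apply.
by exists w; rewrite !inE ?connect0.
Qed.

(** The base exceeds every value of [g], so [k] and [g] act as two digits and comparison is
    lexicographic. *)
Definition lex_rank (k g : T -> nat) x := k x * (\max_y g y).+1 + g x.

Lemma lex_rank_le k g x y :
  (lex_rank k g x <= lex_rank k g y)
    = (k x < k y) || (k x == k y) && (g x <= g y).
Proof.
have gM z : g z < (\max_y g y).+1 by rewrite ltnS leq_bigmax.
rewrite /lex_rank; have := gM x; have := gM y; move: (\max_z g z).+1 => M gyM gxM.
case: (ltngtP (k x) (k y)) => [lt|lt|->] /=; last by rewrite leq_add2l.
  apply: leq_trans (leq_addr _ _); apply: (@leq_trans ((k x).+1 * M)).
    by rewrite mulSnr leq_add2l ltnW.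
  by rewrite leq_mul2r lt orbT.
apply/negbTE; rewrite -ltnNge; apply: leq_trans (leq_addr _ _).
apply: (@leq_trans ((k y).+1 * M)); first by rewrite mulSnr ltn_add2l.
by rewrite leq_mul2r lt orbT.
Qed.

Lemma wreach_on_connect f A v w :
  w \in wreach_on f A v -> connect (induced e A) v w.
Proof.
rewrite inE => /andP[_]; apply: connect_induced_mono.
by apply/subsetP=> u; rewrite inE => /andP[].
Qed.

(** If [w] did not reach [v] back, it would have more ancestors and so a larger rank than [v]. *)
Lemma wreach_on_ancestors_mutual g A v w :
    w \in wreach_on (lex_rank (fun x => #|ancestors A x|) g) A v ->
  mutually_reachable e A v w.
Proof.
move=> wv; have vw := wreach_on_connect wv; rewrite /mutually_reachable /= vw /=.
apply: contraTT (wreach_on_le wv) => /(ancestors_card_lt vw) lt_k.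
by rewrite lex_rank_le negb_or -leqNgt (ltnW lt_k) gtn_eqF.
Qed.

(** Allowing ties lets the rank functions of separate components be combined freely; the ties are
    broken only in the final theorem. *)
Lemma exists_wreach_on_le A :
  exists f, forall v, v \in A -> #|wreach_on f A v| <= (cycle_rank_on e A).+1.
Proof.
have [n] := ubnP #|A|; elim: n A => // n IHn A leAn.
pose k x := #|ancestors A x|.
have [ac|nac] := boolP (acyclic e A).
  (* Only [v] itself is reached: another [w] would be mutually reachable with [v], and the first arc
     of a path from [v] to [w] would lie on a cycle. *)
  exists (lex_rank k (fun=> 0)) => v vA; rewrite cycle_rank_onE ac -(cards1 v).
  apply/subset_leq_card/subsetP=> w /wreach_on_ancestors_mutual/andP[vw wv].
  rewrite inE; apply: contraTT ac => w_neq_v; apply/negPn.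
  case/connectP: vw wv => [[|y p] /=].
    by move=> _ def_w; rewrite def_w eqxx in w_neq_v.
  case/andP=> vy yp def_w wv; apply/existsP; exists v; apply/existsP; exists y.
  by rewrite vy /=; apply: connect_trans wv; apply/connectP; exists p.
have arcA := nacyclic_has_arc nac.
have [sc|nsc] := boolP (strongly_connected e A).
  have A0 : A != set0.
    case/existsP: arcA => x /existsP[y /and3P[xA _ _]].
    by apply/set0Pn; exists x.
  have [[z zA def_min] _] := min_overP (fun u => cycle_rank_on e (A :\ u)) A0.
  have [|f f_le] := IHn (A :\ z).
    by move: leAn; rewrite (cardsD1 z A) zA.
  (* The shift puts [z] strictly first: [z] reaches only itself, and paths witnessing any other
     reached vertex avoid [z]. *)
  pose g x := if x == z then 0 else (f x).+1.
  exists g => v vA; rewrite cycle_rank_onE (negPf nac) sc arcA /= def_min add1n.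
  have [->|v_neq_z] := eqVneq v z.
    apply: (@leq_trans #|[set z]|); last by rewrite cards1.
    apply/subset_leq_card/subsetP=> w /wreach_on_le; rewrite inE /g eqxx.
    by case: eqP.
  have vA' : v \in A :\ z by rewrite !inE v_neq_z.
  apply: (@leq_trans #|z |: wreach_on f (A :\ z) v|).
    apply/subset_leq_card/subsetP=> w; rewrite !inE => /andP[wA vw].
    have [//|w_neq_z /=] := eqVneq w z; rewrite wA /=.
    apply: connect_induced_mono vw; apply/subsetP=> u.
    rewrite !inE /g (negPf w_neq_z).
    by case: eqVneq => //= _; rewrite andbF.
  by rewrite cardsU1 -add1n leq_add ?leq_b1 ?f_le.
pose P := strong_components e A.
have partP := strong_components_partition e A.
have [F F_le] : exists F : {set T} -> T -> nat, forall C, C \in P -> forall v,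
    v \in C -> #|wreach_on (F C) C v| <= (cycle_rank_on e C).+1.
  apply: (@fin_all_exists _ _ (fun C f => C \in P -> forall v, v \in C ->
    #|wreach_on f C v| <= (cycle_rank_on e C).+1)) => C.
  have [CP|_] := boolP (C \in P); last by exists (fun=> 0).
  have [|f f_le] := IHn C; last by exists f.
  rewrite -ltnS (leq_trans _ leAn) // ltnS.
  exact/proper_card/(strong_component_proper nsc).
have /and3P[/eqP covA trivP _] := partP.
(* Ancestor counts order the components, and each component is ordered inside by its own function.
   Components with equal counts may interleave, but weak reach still stays within one component. *)
pose g x := F (pblock P x) x.
exists (lex_rank k g) => v vA; set C := pblock P v.
have CP : C \in P by rewrite pblock_mem ?covA.
have vC : v \in C by rewrite mem_pblock covA.
have mutC x : x \in A -> mutually_reachable e A v x -> x \in C.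
  move=> xA vx; rewrite pblock_equivalence_partition //.
  exact: mutually_reachable_equiv.
apply: (@leq_trans (cycle_rank_on e C).+1); last first.
  by rewrite ltnS cycle_rank_on_component.
apply: leq_trans (F_le C CP v vC).
apply/subset_leq_card/subsetP=> w wv.
have /andP[vw wv'] := wreach_on_ancestors_mutual wv.
have wA : w \in A by move: wv; rewrite inE => /andP[].
have wC : w \in C by rewrite mutC // /mutually_reachable /= vw.
rewrite inE wC /=; move: wv; rewrite inE wA /=.
(* Since [v] and [w] are mutually reachable, such a [u] lies in [C] as well; there [k] is constant,
   so only [F C] compares [w] with [u]. *)
apply: connect_induced_sub => u vu uw.
have sub_A x y :
    connect (induced e [set t in A | lex_rank k g w <= lex_rank k g t]) x y ->
  connect (induced e A) x y.
  by apply: connect_induced_mono; apply/subsetP=> t; rewrite inE => /andP[].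
have uA : u \in A.
  by case/predU1P: (connect_induced_mem (sub_A _ _ vu)) => [<-|/andP[]].
have uv : connect (induced e A) u v by apply: connect_trans (sub_A _ _ uw) wv'.
have uC : u \in C by rewrite mutC // /mutually_reachable /= uv sub_A.
rewrite inE uC /=.
have : lex_rank k g w <= lex_rank k g u.
  case/predU1P: (connect_induced_mem uw) => [->//|].
  by rewrite inE => /andP[/andP[]].
have -> : lex_rank k g w <= lex_rank k g u = (g w <= g u).
  rewrite lex_rank_le; suff -> : k w = k u by rewrite ltnn eqxx.
  apply/eqP; rewrite eqn_leq; apply/andP; split; apply/subset_leq_card/subsetP=> t;
    rewrite !inE => /connect_trans; apply.
    exact: connect_trans wv' (sub_A _ _ vu).
  exact: sub_A.
by rewrite /g !(def_pblock trivP CP).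
Qed.

(** * From rank functions to linear orders *)

Lemma wreach_wreach_on (L : {set T * T}) f v :
    (forall x y, ((x, y) \in L) = (f x <= f y)) ->
  wreach e L v = wreach_on f setT v.
Proof.
move=> Lf; apply/setP=> w.
have -> : (w \in wreach e L v) =
    (f w <= f v) && connect (induced e [set u in setT | f w <= f u]) v w.
  rewrite inE Lf; congr (_ && connect (induced e _) _ _).
  by apply/setP=> u; rewrite !inE Lf.
apply/andP/idP => [[_ vw]|wv]; first by rewrite inE in_setT.
by rewrite (wreach_on_le wv); move: wv; rewrite inE in_setT.
Qed.

End WeakReach.

(** The size of the down-set is such a rank: transitivity nests the down-sets, and if [x] is not
    below [y], then [x] itself makes the inclusion strict. *)
Lemma linear_order_rank (T : finType) (L : {set T * T}) :
  linear_order L ->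
  exists f : T -> nat, forall x y, ((x, y) \in L) = (f x <= f y).
Proof.
case/and4P=> /forallP Lxx /forallP Lanti /forallP Ltrans /forallP Ltot.
have trans x y z : (x, y) \in L -> (y, z) \in L -> (x, z) \in L.
  move=> xy yz; have /forallP/(_ y)/forallP/(_ z) := Ltrans x.
  by rewrite xy yz.
exists (fun x => #|[set z | (z, x) \in L]|) => x y; apply/idP/idP=> [xy|].
  by apply/subset_leq_card/subsetP=> z; rewrite !inE => /trans; apply.
apply: contraTT => nxy; rewrite -ltnNge; apply/proper_card/properP.
have yx : (y, x) \in L by have /forallP/(_ y) := Ltot x; rewrite (negPf nxy).
split; first by apply/subsetP=> z; rewrite !inE => /trans; apply.
by exists x; rewrite !inE ?Lxx.
Qed.

Lemma linear_order_of_rank (T : finType) (f : T -> nat) :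
  injective f -> linear_order [set xy | f xy.1 <= f xy.2].
Proof.
move=> f_inj; apply/and4P; split; apply/forallP=> x; rewrite ?inE //=.
- apply/forallP=> y; rewrite !inE /= -eqn_leq; apply/implyP=> /eqP/f_inj->.
  exact: eqxx.
- apply/forallP=> y; apply/forallP=> z; rewrite !inE /=.
  by apply/implyP=> /andP[]; apply: leq_trans.
- by apply/forallP=> y; rewrite !inE leq_total.
Qed.

Theorem theorem1p3 (T : finType) (e : rel T) (loopless : irreflexive e) :
  cycle_rank e = wcol e - 1.
Proof.
have [[L Lord def_wcol] wcol_min] :=
  min_overP (fun L => \max_(v : T) #|wreach e L v|) (linear_orders_neq0 T).
apply/eqP; rewrite eqn_leq; apply/andP; split.
  have [T0|] := eqVneq [set: T] set0.
    by rewrite /cycle_rank /cycle_rank_on T0 cards0.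
  rewrite inE in Lord; have [f Lf] := linear_order_rank Lord.
  case/(cycle_rank_lt_wreach_on f loopless) => v _ ltv.
  (* Writing the left side as a successor minus 1 reduces the truncated subtraction to its
     monotonicity. *)
  rewrite -[cycle_rank e]subn0 -[_ - 0]/(_.+1 - 1) leq_sub2r //.
  rewrite /wcol def_wcol (leq_trans ltv) //.
  rewrite -(wreach_wreach_on e v Lf).
  exact: (leq_bigmax (F := fun u => #|wreach e L u|)).
rewrite leq_subLR add1n.
have [f f_le] := exists_wreach_on_le e [set: T].
(* The enumeration of [T] breaks the ties of [f], giving a linear order whose weak reaches are
   contained in those of [f]. *)
pose f' := lex_rank f (fun x => enum_rank x).
have f'_inj : injective f'.
  move=> x y eq_f; have := lex_rank_le f (fun x => enum_rank x) x y.
  have := lex_rank_le f (fun x => enum_rank x) y x.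
  rewrite -/f' -/(f' x) -/(f' y) eq_f leqnn.
  case: ltngtP => //= _ /esym le_yx /esym le_xy.
  by apply/enum_rank_inj/val_inj/eqP; rewrite eqn_leq le_xy.
have /wcol_min : [set xy | f' xy.1 <= f' xy.2] \in linear_orders T.
  by rewrite inE linear_order_of_rank.
move/leq_trans; apply; apply/bigmax_leqP=> v _.
rewrite (@wreach_wreach_on _ e _ f'); last by move=> x y; rewrite inE.
apply: leq_trans (f_le v (in_setT v)); apply/subset_leq_card/wreach_on_mono.
by move=> x y; rewrite lex_rank_le => /orP[/ltnW|/andP[/eqP-> _]].
Qed.
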